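(* Let $M$ be an incomplete matrix over a field $\mathbb{F}$ and let $v$ be an incomplete column vector over $\mathbb{F}$ with the same number of rows as $M$. For $1\le i\le t$, let $M_{d_i}$ denote the $d_i$-th column of $M$, and assume each $M_{d_i}$ is a donor for $v$, so that after some interchanging of rows $$[v\,|\,M_{d_1}\,M_{d_2}\cdots M_{d_t}]=\begin{pmatrix}\bar r & \bar D\\ ? & N\end{pmatrix},$$ where all entries of the column vector $\bar r$ and of the matrix $\bar D$ are known and the block marked $?$ is entirely unknown (that is, the upper rows are exactly those in which $v$ is known). If $\bar r\in \mathrm{Col}(\bar D)$, then $$mr([v\,|\,M])=mr(M).$$
   Context: An incomplete matrix (or vector) over a field $\mathbb{F}$ is a finite-size matrix (vector) each of whose entries is either a known element of $\mathbb{F}$ or unknown (written $?$). A completion of $M$ is a matrix over $\mathbb{F}$ of the same size that agrees with $M$ at all known entries; $S(M)$ is the set of completions of $M$, and $mr(M)=\min_{\bar M\in S(M)}\mathrm{rank}\,\bar M$. For two incomplete vectors $v,w$ of the same length, $v$ is a donor for $w$ if every position at which $v$ is unknown is also a position at which $w$ is unknown. $[v\,|\,M]$ denotes the matrix obtained by adjoining $v$ as an extra column to $M$, and $\mathrm{Col}(\bar D)$ denotes the column space of $\bar D$ over $\mathbb{F}$. *)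

(* Defs.v *)
From mathcomp Require Import all_boot all_order all_fingroup all_algebra.
From mathcomp Require Import boolp.

Set Implicit Arguments.
Unset Strict Implicit.
Unset Printing Implicit Defensive.

Local Open Scope ring_scope.

(* An incomplete m x n matrix over F is a term of type 'M[option F]_(m, n):   *)
(* Some a is a known entry, None is an unknown entry.                         *)

Definition completion (F : fieldType) (m n : nat)
    (M : 'M[option F]_(m, n)) (A : 'M[F]_(m, n)) : Prop :=
  forall i j a, M i j = Some a -> A i j = a.

Definition completion_rank (F : fieldType) (m n : nat)
    (M : 'M[option F]_(m, n)) (r : nat) : bool :=
  `[< exists2 A : 'M[F]_(m, n), completion M A & \rank A = r >].

Lemma completion_rank_ex (F : fieldType) (m n : nat)
    (M : 'M[option F]_(m, n)) : exists r, completion_rank M r.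
Proof.
pose A := map_mx (odflt 0) M.
exists (\rank A); apply/asboolP; exists A => // i j a.
by rewrite mxE => ->.
Qed.

Definition mr (F : fieldType) (m n : nat) (M : 'M[option F]_(m, n)) : nat :=
  ex_minn (completion_rank_ex M).

Definition donor (F : fieldType) (m : nat) (v w : 'cV[option F]_m) : Prop :=
  forall i, v i 0 = None -> w i 0 = None.

(* MathComp subspaces are row spaces, hence the transpositions. *)
Definition in_colspace (F : fieldType) (m n : nat)
    (r : 'cV[F]_m) (D : 'M[F]_(m, n)) : bool :=
  (r^T <= D^T)%MS.

(* s interchanges the rows of [v | N] into the block form                     *)
(*     / r  D  \                                                              *)
(*     \ ?  N' /                                                              *)
(* with r and D entirely known; the p upper rows are then exactly the rows in *)
(* which v is known.                                                          *)
Definition donor_block_form (F : fieldType) (m p q t : nat)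
    (mE : m = (p + q)%N) (s : 'S_m)
    (v : 'cV[option F]_m) (N : 'M[option F]_(m, t))
    (r : 'cV[F]_p) (D : 'M[F]_(p, t)) (N' : 'M[option F]_(q, t)) : Prop :=
  castmx (mE, erefl) (row_perm s (row_mx v N)) =
    block_mx (map_mx some r) (map_mx some D) (const_mx None) N'.

(* The block form always exists when the columns of N are donors for v. *)
Lemma donor_block_form_ex (F : fieldType) (m t : nat)
    (v : 'cV[option F]_m) (N : 'M[option F]_(m, t)) :
  (forall j, donor (col j N) v) ->
  exists p q (mE : m = (p + q)%N) (s : 'S_m) r D N',
    donor_block_form (p := p) (q := q) mE s v N r D N'.
Proof.
move=> dN; pose K := [set i | v i 0 != None].
have mE : m = (#|K| + #|~: K|)%N by rewrite cardsC card_ord.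
pose f (i : 'I_m) := match split (cast_ord mE i) with
  | inl k => enum_val k | inr k => enum_val k end.
have f_inj : injective f.
  move=> i j; rewrite /f => eqf; apply: (@cast_ord_inj _ _ mE).
  apply: (can_inj splitK); move: eqf.
  case: (split _) => k; case: (split _) => l eqf.
  - by rewrite (enum_val_inj eqf).
  - by have := enum_valP l; rewrite -eqf inE enum_valP.
  - by have := enum_valP k; rewrite eqf inE enum_valP.
  - by rewrite (enum_val_inj eqf).
exists #|K|, #|~: K|, mE, (perm f_inj).
exists (\col_k odflt 0 (v (enum_val k) 0)).
exists (\matrix_(k, j) odflt 0 (N (enum_val k) j)).
exists (\matrix_(k, j) N (enum_val k) j).
have fK i : f (cast_ord (esym mE) i) =
    match split i with inl k => enum_val k | inr k => enum_val k end.
  by rewrite /f cast_ordKV.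
apply/matrixP => i j; rewrite castmxE !mxE permE fK cast_ord_id.
case: (split i) => k; rewrite mxE; case: (split j) => l; rewrite !mxE ?ord1.
- by have := enum_valP k; rewrite inE; case: (v _ _).
- have := enum_valP k; rewrite inE; case NE: (N _ _) => [//|].
  by rewrite (dN l) ?eqxx // mxE.
- by have := enum_valP k; rewrite !inE negbK => /eqP.
- by [].
Qed.

(* Main.v *)
(* If r = D x, then in a completion A of M of minimal rank the combination of
   the columns d_i of A with coefficients x agrees with v wherever v is known,
   so it completes v without leaving the column space of A. *)
Require Import Defs.
From mathcomp Require Import all_boot all_order all_fingroup all_algebra.
From mathcomp Require Import boolp.

Set Implicit Arguments.
Unset Strict Implicit.
Unset Printing Implicit Defensive.

Import GRing.Theory.

Local Open Scope ring_scope.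

Lemma mr_le_rank (F : fieldType) (m n : nat) (M : 'M[option F]_(m, n))
    (A : 'M[F]_(m, n)) :
  completion M A -> (mr M <= \rank A)%N.
Proof.
move=> MA; rewrite /mr; case: ex_minnP => k _; apply.
by apply/asboolP; exists A.
Qed.

Lemma mr_attained (F : fieldType) (m n : nat) (M : 'M[option F]_(m, n)) :
  exists2 A : 'M[F]_(m, n), completion M A & \rank A = mr M.
Proof. by rewrite /mr; case: ex_minnP => k /asboolP. Qed.

Lemma completion_rsubmx (F : fieldType) (m n1 n2 : nat)
    (M1 : 'M[option F]_(m, n1)) (M2 : 'M[option F]_(m, n2))
    (B : 'M[F]_(m, n1 + n2)) :
  completion (row_mx M1 M2) B -> completion M2 (rsubmx B).
Proof. by move=> MB i j a Ma; rewrite mxE; apply: MB; rewrite row_mxEr. Qed.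

Lemma mxrank_rsubmx (F : fieldType) (m n1 n2 : nat)
    (B : 'M[F]_(m, n1 + n2)) :
  (\rank (rsubmx B) <= \rank B)%N.
Proof.
have <- : B *m col_mx 0 1%:M = rsubmx B.
  by rewrite -[in LHS](hsubmxK B) mul_row_col mulmx0 mulmx1 add0r.
exact: mxrankM_maxl.
Qed.

(** The lower left block is entirely unknown, so a row in which [v] is known can only land in the
    upper blocks. This is all that the rank argument uses of the block form. *)
Lemma donor_block_known_row (F : fieldType) (m p q t : nat)
    (mE : m = (p + q)%N) (s : 'S_m)
    (v : 'cV[option F]_m) (N : 'M[option F]_(m, t))
    (r : 'cV[F]_p) (D : 'M[F]_(p, t)) (N' : 'M[option F]_(q, t))
    (i : 'I_m) (a : F) :
  donor_block_form mE s v N r D N' -> v i 0 = Some a ->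
  exists2 k : 'I_p, r k 0 = a & forall j, N i j = Some (D k j).
Proof.
move=> blockE via.
(* Row [k] of [row_perm s] is the original row [s k], so the original row [i] is found at position
   [s^-1 i]. *)
have rowE j : row_mx v N i j =
    block_mx (map_mx some r) (map_mx some D) (const_mx None) N'
      (cast_ord mE ((s^-1)%g i)) j.
  by rewrite -blockE castmxE cast_ordK cast_ord_id !mxE permKV.
have:= rowE (lshift t 0); rewrite row_mxEl via.
case: (split_ordP (cast_ord mE ((s^-1)%g i))) => k kE; rewrite kE.
  rewrite block_mxEul mxE => -[->]; exists k => // j.
  by have:= rowE (rshift 1 j); rewrite row_mxEr kE block_mxEur mxE.
by rewrite block_mxEdl mxE.
Qed.

Theorem theorem5p1 (F : fieldType) (m n t p q : nat)
    (M : 'M[option F]_(m, n)) (v : 'cV[option F]_m) (d : 'I_t -> 'I_n)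
    (donors : forall i : 'I_t, donor (col (d i) M) v)
    (mE : m = (p + q)%N) (s : 'S_m)
    (r : 'cV[F]_p) (D : 'M[F]_(p, t)) (N : 'M[option F]_(q, t))
    (blockE : donor_block_form mE s v (colsub d M) r D N)
    (rD : in_colspace r D) :
  mr (row_mx v M) = mr M.
Proof.
apply/eqP; rewrite eqn_leq; apply/andP; split; last first.
  (* Deleting the first column of an optimal completion of [[v | M]] completes [M] without raising
     the rank. *)
  have [B vMB <-] := mr_attained (row_mx v M).
  exact: leq_trans (mr_le_rank (completion_rsubmx vMB))
                   (mxrank_rsubmx _).
have [A MA <-] := mr_attained M.
have /submxP[x rx] := rD.
have {}rx : r = D *m x^T by rewrite -[r]trmxK rx trmx_mul trmxK.
pose w := colsub d A *m x^T.
have vMw : completion (row_mx v M) (row_mx w A).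
  move=> i j a; case: (split_ordP j) => l ->; rewrite ?row_mxEr ?row_mxEl.
    rewrite ord1 => /(donor_block_known_row blockE).
    (* Row [k] of [D] consists of known entries of [M], which [A] must reproduce; hence [w] takes
       the value [(D x) k = r k] there. *)
    case=> k <- MiE; rewrite rx !mxE; apply: eq_bigr => h _.
    by have:= MiE h; rewrite !mxE => /MA ->.
  exact: MA.
apply: leq_trans (mr_le_rank vMw) _.
(* Selecting columns is right multiplication by [colsub d 1%:M], so [[w | A]] factors through [A],
   which bounds its rank. *)
have -> : row_mx w A = A *m row_mx (colsub d 1%:M *m x^T) 1%:M.
  by rewrite mul_mx_row mulmx1 mulmxA mulmx_colsub mulmx1.
exact: mxrankM_maxl.
Qed.
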